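(* Let $R$ be a $\sigma$-compact locally compact Hausdorff space, let $\Phi$ be a normalized completely alternating capacity on the class $\mathcal{K}$ of compact subsets of $R$, and let $\lambda$ be the unique Radon (probability) measure on $\mathcal{F}'$ satisfying $\Phi(Q)=\lambda(\{F\in\mathcal{F}': Q\cap F\ne\varnothing\})$ for all $Q\in\mathcal{K}$. If $\Phi$ is a locally finite valuation, then $\lambda$ uniquely determines the distribution of a simple point process; that is, $\lambda(\mathcal{F}'\setminus\mathcal{P}_{\mathrm{lf}})=0$, so that a random closed set $\xi$ with distribution $\lambda$ is almost surely locally finite and $N(Q)=|\xi\cap Q|$, $Q\in\mathcal{K}$, is a simple point process whose distribution is determined by $\lambda$.
   Context: $\mathcal{F}'$ is the space of nonempty closed subsets of $R$ with the Fell topology (subbase: $\{F: F\cap Q=\varnothing\}$, $Q\in\mathcal{K}$, and $\{F: F\cap G\ne\varnothing\}$, $G$ open in $R$); it is locally compact Hausdorff. A Radon measure is a Borel measure, finite on compact sets, inner regular on open sets and outer regular on Borel sets. A closed set $F\subseteq R$ is locally finite if $F\cap Q$ is finite for every $Q\in\mathcal{K}$; $\mathcal{P}_{\mathrm{lf}}$ is the collection of locally finite closed sets. A capacity is a function $\Phi:\mathcal{K}\to[0,\infty)$ with $\Phi(\varnothing)=0$ that is increasing and continuous on the right: for every $E\in\mathcal{K}$, $\varepsilon>0$ there is an open $G\supseteq E$ with $|\Phi(F)-\Phi(E)|<\varepsilon$ whenever $F\in\mathcal{K}$, $E\subseteq F\subseteq G$. It is normalized if $\sup_{Q\in\mathcal{K}}\Phi(Q)=1$.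 Put $\nabla_{Q_1}\Phi(Q)=\Phi(Q)-\Phi(Q\cup Q_1)$ and $\nabla_{Q_1,\ldots,Q_n}\Phi=\nabla_{Q_n}(\nabla_{Q_1,\ldots,Q_{n-1}}\Phi)$. $\Phi$ is completely alternating if $\nabla_{Q_1,\ldots,Q_n}\Phi(Q)\le0$ for all $n\ge 1$ and $Q,Q_1,\ldots,Q_n\in\mathcal{K}$; the existence and uniqueness of $\lambda$ for such $\Phi$ is Choquet's theorem. A capacity $\Phi$ is a valuation if $\Phi(Q_1)+\Phi(Q_2)=\Phi(Q_1\cup Q_2)+\Phi(Q_1\cap Q_2)$ for all $Q_1,Q_2\in\mathcal{K}$. A point process is a family $N(Q)$, $Q\in\mathcal{K}$, of nonnegative integer-valued random variables on a probability space such that $Q\mapsto N(Q)$ is a (random) valuation; it is simple if $N(\{a\})\le 1$ for every $a\in R$. Locally finite valuation. For $W\in\mathcal{K}$, a subsemilattice covering of $W$ is a finite set $\mathcal{G}\subseteq\mathcal{K}$ such that $Q_1\cap Q_2\in\mathcal{G}$ whenever $Q_1,Q_2\in\mathcal{G}$, and $\bigcup\mathcal{G}=W$. Put $\mathcal{G}'=\mathcal{G}\setminus\{\bigcap\mathcal{G}\}$. For an antichain $Q_1,\ldots,Q_k$ ($k\ge1$) of $\mathcal{G}'$ (pairwise non-comparable under inclusion) put $O_{Q_1,\ldots,Q_k}=\bigcup\{Q\in\mathcal{G}: Q_i\not\subseteq Q\text{ for all }i=1,\ldots,k\}$ (the empty set if the collection is empty); call it an opening if $Q_i\not\subseteq O_{Q_1,\ldots,Q_k}$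 for all $i=1,\ldots,k$. The capacity $\Phi$ is a locally finite valuation if for every $\delta>0$ and $W\in\mathcal{K}$ there is a sufficiently large $n$ such that for every subsemilattice covering $\mathcal{G}$ of $W$, $$-\sum\nabla_{Q_1,\ldots,Q_k}\Phi(O_{Q_1,\ldots,Q_k})\ \ge\ \Phi(W)-\delta,$$ where the sum is over all antichains $Q_1,\ldots,Q_k$ of $\mathcal{G}'$ with $k\le n$ such that $O_{Q_1,\ldots,Q_k}$ is an opening.
   Formalization: Subsemilattice coverings are required to contain the empty set: as printed, the covering {W} has G' empty, so the condition would force Φ(W) ≤ δ for all W and δ > 0, contradicting normalization; the mended hypothesis is implied by the printed one. *)

(* Defs.v *)
From HB Require Import structures.
From mathcomp Require Import all_boot all_order all_algebra.
From mathcomp Require Import finmap.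
From mathcomp Require Import all_classical all_reals all_analysis.

Set Implicit Arguments.
Unset Strict Implicit.
Unset Printing Implicit Defensive.

Import Order.TTheory GRing.Theory Num.Theory.
Local Open Scope classical_set_scope.
Local Open Scope ring_scope.

Definition sigma_compact (T : topologicalType) : Prop :=
  exists2 K : nat -> set T, (forall n, compact (K n)) & \bigcup_n K n = setT.

(** Set functions on the class of compact sets are functions on [set T] of
    which only the values at compact sets are ever constrained or used. *)

Section capacities.
Context {R : realType} {T : topologicalType}.
Implicit Types (Phi : set T -> R) (Q W : set T).

Definition right_continuous_on_compacts Phi : Prop :=
  forall E, compact E -> forall eps : R, 0 < eps ->
  exists G, [/\ open G, E `<=` G &
    forall F, compact F -> E `<=` F -> F `<=` G -> `|Phi F - Phi E| < eps].

Definition capacity Phi : Prop :=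
  [/\ forall Q, compact Q -> 0 <= Phi Q,
      Phi set0 = 0,
      forall Q1 Q2, compact Q1 -> compact Q2 -> Q1 `<=` Q2 -> Phi Q1 <= Phi Q2
    & right_continuous_on_compacts Phi].

Definition normalized Phi : Prop := has_sup [set Phi Q | Q in compact] /\
  sup [set Phi Q | Q in compact] = 1.

Definition nabla1 Q1 Phi : set T -> R := fun Q => Phi Q - Phi (Q `|` Q1).

Definition nabla (s : seq (set T)) Phi : set T -> R :=
  foldl (fun Psi Q1 => nabla1 Q1 Psi) Phi s.

Definition completely_alternating Phi : Prop :=
  forall (s : seq (set T)) Q, s != [::] -> (forall Q1, Q1 \in s -> compact Q1) ->
  compact Q -> nabla s Phi Q <= 0.

Definition valuation Phi : Prop := capacity Phi /\
  forall Q1 Q2, compact Q1 -> compact Q2 ->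
    Phi Q1 + Phi Q2 = Phi (Q1 `|` Q2) + Phi (Q1 `&` Q2).

End capacities.

Section locally_finite_valuations.
Local Open Scope fset_scope.
Context {R : realType} {T : topologicalType}.
Implicit Types (Phi : set T -> R) (W : set T) (G A : {fset set T}).

(** The compact sets are a meet-semilattice with least element the empty set,
    and a subsemilattice is required to contain it.  Without this, for compact
    [W] the covering [[fset W]] would have no antichain to sum over, and only
    the zero capacity could be a locally finite valuation.  As there are fewer
    coverings, requiring it makes [locally_finite_valuation] weaker. *)
Definition subsemilattice_covering W G : Prop :=
  [/\ forall Q, Q \in G -> compact Q,
      set0 \in G,
      forall Q1 Q2, Q1 \in G -> Q2 \in G -> (Q1 `&` Q2)%classic \in G
    & (\bigcup_(Q in [set` G]) Q)%classic = W].

Definition remove_meet G : {fset set T} :=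
  G `\ (\bigcap_(Q in [set` G]) Q)%classic.

Definition antichain A : Prop := A != fset0 /\
  forall Q1 Q2, Q1 \in A -> Q2 \in A -> Q1 != Q2 -> ~ (Q1 `<=` Q2)%classic.

Definition avoiding G A : set T :=
  (\bigcup_(Q in [set Q | Q \in G /\
     forall Q1, Q1 \in A -> ~ (Q1 `<=` Q)]) Q)%classic.

Definition is_opening G A : Prop :=
  forall Q, Q \in A -> ~ (Q `<=` avoiding G A)%classic.

(** [nabla (enum_fset A)] does not depend on the order of enumeration, the
    operators [nabla1 Q] commute. *)
Definition locally_finite_valuation Phi : Prop :=
  forall (delta : R) W, 0 < delta -> compact W ->
  exists n : nat, forall G, subsemilattice_covering W G ->
    Phi W - delta <=
    - \sum_(A <- fpowerset (remove_meet G)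
        | (#|` A| <= n)%N && `[< antichain A /\ is_opening G A >])
        nabla (enum_fset A) Phi (avoiding G A).

End locally_finite_valuations.

(** Nonempty closed sets with the Fell topology. *)

Definition fell (T : ptopologicalType) : Type :=
  {F : set T | closed F /\ F !=set0}.

Section fell_space.
Context {T : ptopologicalType}.

Definition fell_set (F : fell T) : set T := proj1_sig F.

Lemma fell_pointP :
  closed (closure [set point : T]) /\ closure [set point : T] !=set0.
Proof.
split; first exact: closed_closure.
by exists point; exact: subset_closure.
Qed.

HB.instance Definition _ := gen_eqMixin (fell T).
HB.instance Definition _ := gen_choiceMixin (fell T).
HB.instance Definition _ := isPointed.Build (fell T) (exist _ _ fell_pointP).

Definition miss (Q : set T) : set (fell T) := [set F | fell_set F `&` Q = set0].

Definition hit (Q : set T) : set (fell T) := [set F | fell_set F `&` Q !=set0].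

Definition fell_subbase : set (set (fell T)) :=
  [set miss Q | Q in compact] `|` [set hit G | G in open].

HB.instance Definition _ :=
  isSubBaseTopological.Build (fell T) fell_subbase id.

Definition locally_finite (F : fell T) : Prop :=
  forall Q, compact Q -> finite_set (fell_set F `&` Q).

End fell_space.

Notation borel X := (g_sigma_algebraType (@open X)).

Definition radon {R : realType} {X : ptopologicalType}
    (mu : {measure set (borel X) -> \bar R}) : Prop :=
  [/\ forall K : set X, compact K -> (mu K < +oo)%E,
      forall U : set X, open U ->
        mu U = ereal_sup [set mu K | K in [set K : set X | compact K /\ K `<=` U]]
    & forall B : set (borel X), measurable B ->
        mu B = ereal_inf [set mu U | U in [set U : set X | open U /\ B `<=` U]]].

Section point_processes.
Context {T : ptopologicalType}.
Implicit Types N : set T -> nat.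

Section processes.
Context d (Omega : measurableType d).

Definition point_process (R : realType) (N : set T -> Omega -> nat) : Prop :=
  (forall Q, compact Q -> measurable_fun [set: Omega] (N Q)) /\
  (forall w, valuation (fun Q => (N Q w)%:R : R)).

Definition simple (N : set T -> Omega -> nat) : Prop :=
  forall a w, (N [set a] w <= 1)%N.

End processes.

(** The sigma-algebra on realizations is generated by the counts of compact
    sets only, so that a probability on [realizations] is the distribution of a
    family indexed by the compact sets. *)
Definition count_cylinders : set (set (set T -> nat)) :=
  [set [set N | N Q = k] | Q in compact & k in [set: nat]].

Definition realizations := g_sigma_algebraType count_cylinders.

(** Realizations of [xi] that are not locally finite are sent to the zero
    process, so that the counts form a point process on the whole space. *)
Definition count_points (Omega : Type) (xi : Omega -> fell T)
    (Q : set T) (w : Omega) : nat :=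
  if `[< locally_finite (xi w) >]
  then #|` fset_set (fell_set (xi w) `&` Q)| else 0%N.

Context {R : realType}.

Definition has_distribution (lambda : probability (borel (fell T)) R)
    d (Omega : measurableType d) (P : probability Omega R)
    (xi : {mfun Omega >-> borel (fell T)}) : Prop :=
  forall B : set (borel (fell T)), measurable B ->
    distribution P xi B = lambda B.

(** [mu] is the distribution of the process of counts of every random closed
    set with distribution [lambda]. *)
Definition is_count_distribution (lambda : probability (borel (fell T)) R)
    (mu : probability realizations R) : Prop :=
  forall d (Omega : measurableType d) (P : probability Omega R)
    (xi : {mfun Omega >-> borel (fell T)}), has_distribution lambda P xi ->
  forall A : set realizations, measurable A ->
    P [set w | A (fun Q => count_points xi Q w)] = mu A.

End point_processes.

(* Main.v *)
(** Since [Phi Q = lambda (hit Q)], the summand [- nabla A Phi (avoiding G A)] is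
    the [lambda]-measure of the closed sets that hit every member of [A] and miss
    [avoiding G A], that is, whose minimal hit members of [G] are exactly [A].
    These cells are disjoint, so local finiteness of [Phi] says that, up to
    measure [delta], a random closed set hitting [W] has at most [n] minimal hit
    members, whatever [G] is.  Having more than [n] points in the interior of [W]
    is an open condition; by inner regularity and compactness its measure is
    approximated by finitely many conditions "hit [n + 1] given disjoint compact
    sets", and a covering [G] containing all these compact sets shows that the
    measure is at most [delta].  Exhausting the space by such interiors gives
    almost sure local finiteness. *)

Require Import Defs.
From HB Require Import structures.
From mathcomp Require Import all_boot all_order all_algebra.
From mathcomp Require Import finmap.
From mathcomp Require Import ring.
From mathcomp Require Import all_classical all_reals all_analysis.

Set Implicit Arguments.
Unset Strict Implicit.
Unset Printing Implicit Defensive.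

Import Order.TTheory GRing.Theory Num.Theory.
Local Open Scope classical_set_scope.
Local Open Scope ring_scope.

(** * Compact neighbourhoods in locally compact Hausdorff spaces *)

Lemma compact_setI (T : topologicalType) (A B : set T) :
  hausdorff_space T -> compact A -> compact B -> compact (A `&` B).
Proof.
by move=> hT cA cB; exact/(compact_closedI cA)/(compact_closed hT).
Qed.

Lemma open_setD (T : topologicalType) (U C : set T) :
  open U -> closed C -> open (U `\` C).
Proof.
by move=> oU cC; rewrite setDE; apply: openI => //; exact: closed_openC.
Qed.

Lemma finite_closed (T : topologicalType) (A : set T) :
  hausdorff_space T -> finite_set A -> closed A.
Proof. by move=> hT fA; exact/(compact_closed hT)/finite_compact. Qed.

(** A compact neighbourhood [V] of [x] is regular, so some smaller neighbourhood has its closure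
    inside both [V] and [U], and that closure is compact. *)
Lemma compact_interior_nbhs (T : topologicalType) (x : T) (U : set T) :
  locally_compact [set: T] -> hausdorff_space T -> open U -> U x ->
  exists C, [/\ compact C, C° x & C `<=` U].
Proof.
move=> lT hT oU Ux; have [V nV' [cV _]] := lT x I.
have nV : nbhs x V.
  by apply: (@filterS _ (nbhs x) _ [set y | [set: T] y -> V y]) nV' => y; exact.
have nVU : nbhs x (V `&` U).
  by apply: filterI => //; exact: open_nbhs_nbhs (conj oU Ux).
have [B /= nB BVU] := compact_regular hT cV nV nVU.
exists (closure B); split; last by move=> y /BVU [].
- apply: (subclosed_compact _ cV); first exact: closed_closure.
  by move=> y /BVU [].
- by apply: filterS nB; exact: subset_closure.
Qed.

(** * The Fell topology and the open events of having many points *)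

Section fell_topology.
Context {T : ptopologicalType}.
Implicit Types (Q U V C : set T) (F : fell T) (s : seq (set T)).

Lemma open_fell_subbase (A : set (fell T)) : fell_subbase A -> open A.
Proof.
move=> sA; exists [set A]; last by rewrite bigcup_set1.
move=> _ ->; exists [fset A]%fset.
  by move=> B /fset1P ->; rewrite inE.
by rewrite set_fset1 bigcap_set1.
Qed.

Lemma open_miss Q : compact Q -> open (@miss T Q).
Proof. by move=> cQ; apply: open_fell_subbase; left; exists Q. Qed.

Lemma open_hit U : open U -> open (@hit T U).
Proof. by move=> oU; apply: open_fell_subbase; right; exists U. Qed.

Lemma hitE Q : @hit T Q = ~` miss Q.
Proof.
by apply/seteqP; split=> [F [x Fx] e|F /eqP/set0P //]; move: Fx; rewrite e.
Qed.

Lemma missU Q1 Q2 : @miss T (Q1 `|` Q2) = miss Q1 `&` miss Q2.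
Proof.
apply/seteqP; split=> F; rewrite /miss /= setIUr; last by case=> -> ->; rewrite setU0.
by rewrite setU_eq0.
Qed.

Lemma fell_set_inj : injective (@fell_set T).
Proof. by move=> [F1 h1] [F2 h2] F12; exact: eq_exist. Qed.

(** A point of one closed set outside another has a compact neighbourhood [C] missing the latter,
    and [hit C°] and [miss C] separate the two. It follows that compact subsets of [fell T] are
    Borel. *)
Lemma fell_hausdorff : locally_compact [set: T] -> hausdorff_space T ->
  hausdorff_space (fell T).
Proof.
move=> lT hT.
have sep F1 F2 : ~ (fell_set F1 `<=` fell_set F2) ->
    exists A B : set (fell T), [/\ open A, open B, A F1, B F2 & A `&` B = set0].
  move=> /existsNP[x /not_implyP[F1x F2x]].
  have cF2 : closed (fell_set F2) by case: F2 F2x => ? [].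
  have [C [cC Cx CF2]] := compact_interior_nbhs lT hT (closed_openC cF2) F2x.
  exists (hit C°), (miss C); split.
  - exact/open_hit/open_interior.
  - exact: open_miss.
  - by exists x.
  - by apply/eqP/negPn/negP => /set0P[y [F2y /CF2]].
  - apply/eqP/negPn/negP => /set0P[F [[y [Fy /interior_subset Cy]] mF]].
    by move: (conj Fy Cy : (fell_set F `&` C) y); rewrite mF.
rewrite open_hausdorff => F1 F2 neq12.
have : ~ (fell_set F1 `<=` fell_set F2) \/ ~ (fell_set F2 `<=` fell_set F1).
  apply/not_andP => -[F12 F21]; move/eqP: neq12; apply.
  exact/fell_set_inj/seteqP.
move=> [/sep|/sep] [A [B [oA oB A1 B2 AB0]]].
- by exists (A, B); split => //=; rewrite ?inE.
- by exists (B, A); split => //=; rewrite ?inE// setIC.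
Qed.

Definition packing V s : Prop :=
  (forall C, C \in s -> compact C /\ C `<=` V) /\
  pairwise (fun C D => `[< C `&` D = set0 >]) s.

Definition hits s : set (fell T) := [set F | forall C, C \in s -> hit C F].

Definition interior_hits s : set (fell T) :=
  [set F | forall C, C \in s -> hit C° F].

(** At least [k] points in [V], see [hit_manyP], phrased through compact sets
    that can be put into a subsemilattice covering. *)
Definition hit_many V (k : nat) : set (fell T) :=
  \bigcup_(s in [set s | packing V s /\ size s = k]) interior_hits s.

Lemma open_interior_hits s : open (interior_hits s).
Proof.
elim: s => [|C s IH].
  have -> : interior_hits [::] = setT by apply/seteqP; split.
  exact: openT.
have -> : interior_hits (C :: s) = hit C° `&` interior_hits s.
  apply/seteqP; split=> [F sF|F [CF sF] D].
    by split=> [|D Ds]; apply: sF; rewrite inE ?eqxx// Ds orbT.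
  by rewrite inE => /predU1P[->//|]; exact: sF.
by apply: openI IH; exact/open_hit/open_interior.
Qed.

Lemma open_hit_many V k : open (hit_many V k).
Proof. by apply: bigcup_open => s _; exact: open_interior_hits. Qed.

(** The first point gets a compact neighbourhood [C] away from the others, which by induction are
    packed into the open set [V] minus [C]; this keeps the packing disjoint. *)
Lemma hit_many_points V F (t : seq T) :
  locally_compact [set: T] -> hausdorff_space T -> open V ->
  uniq t -> [set` t] `<=` fell_set F `&` V -> hit_many V (size t) F.
Proof.
move=> lT hT; elim: t V => [|x t IH] V oV.
  by move=> _ _; exists [::] => //.
move=> /= /andP[xt ut] tV.
have [Fx Vx] : (fell_set F `&` V) x by apply: tV; rewrite /= mem_head.
have ft : finite_set [set` t] by exact: finite_seq.
have [C [cC Cx CV]] := compact_interior_nbhs lT hT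
  (open_setD oV (finite_closed hT ft)) (conj Vx (negP xt)).
have [||s [[sV ps] ssz] sF] := IH (V `\` C) _ ut.
- by apply: open_setD => //; exact: compact_closed.
- move=> y ty; have [Fy Vy] : (fell_set F `&` V) y.
    by apply: tV; rewrite /= inE; apply/orP; right.
  by split=> //; split=> // /CV [].
exists (C :: s).
  split; last by rewrite /= ssz.
  split.
    move=> D; rewrite inE => /predU1P[->|/sV [cD DV]].
      by split=> // y /CV [].
    by split=> // y /DV [].
  rewrite /= ps andbT; apply/allP => D /sV [_ DV]; apply/asboolP.
  by rewrite -subset0 => y [Cy /DV [_]].
by move=> D; rewrite inE => /predU1P[->|/sF //]; exists x.
Qed.

(** Serves twice: for points chosen in the sets of a packing, and for antichain members chosen
    inside them. With [C = D], the second hypothesis makes every member of [s] nonempty. *)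
Lemma uniq_map_disjoint (U : eqType) (f : set T -> U) s :
  pairwise (fun C D => `[< C `&` D = set0 >]) s ->
  {in s &, forall C D, f C = f D -> C `&` D !=set0} -> uniq (map f s).
Proof.
move=> ps fs; rewrite uniq_pairwise pairwise_map.
apply/(pairwiseP set0) => i j si sj ij; apply/eqP => /fs.
rewrite !mem_nth// => /(_ isT isT)/set0P/eqP; apply.
by move/(pairwiseP set0) : ps => /(_ i j si sj ij)/asboolP.
Qed.

Lemma hit_manyP V F k :
  locally_compact [set: T] -> hausdorff_space T -> open V ->
  hit_many V k F <->
  exists t : seq T, [/\ uniq t, [set` t] `<=` fell_set F `&` V & size t = k].
Proof.
move=> lT hT oV; split=> [[s [[sV ps] <-] sF]|[t [ut tV <-]]]; last first.
  exact: hit_many_points.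
pose f C := xget point (fell_set F `&` C).
have fC C : C \in s -> (fell_set F `&` C) (f C).
  move=> /sF [x [Fx /interior_subset Cx]].
  by apply: (@xgetPex _ point); exists x.
exists (map f s); split; last by rewrite size_map.
- apply: uniq_map_disjoint ps _ => C D Cs Ds e; exists (f C).
  by split; [exact: (fC _ Cs).2|rewrite e; exact: (fC _ Ds).2].
- move=> x /mapP[C Cs ->]; have [FC CC] := fC _ Cs.
  by split=> //; apply: (sV _ Cs).2.
Qed.

Lemma infinite_hit_many V F :
  locally_compact [set: T] -> hausdorff_space T -> open V ->
  infinite_set (fell_set F `&` V) <-> forall k, hit_many V k F.
Proof.
move=> lT hT oV; rewrite infinite_set_fsetP; split=> H k.
  have [A AV kA] := H k; apply/hit_manyP => //.
  exists (take k A); split; last by rewrite size_takel.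
  - by rewrite take_uniq// fset_uniq.
  - by move=> x /mem_take /AV.
have /hit_manyP [//|//|//|t [ut tV tk]] := H k.
exists [fset x in t]%fset; first by move=> x; rewrite /= !inE => /tV.
by rewrite card_fseq undup_id// tk.
Qed.

Lemma finite_hit_many V F k :
  locally_compact [set: T] -> hausdorff_space T -> open V ->
  finite_set (fell_set F `&` V) ->
  hit_many V k F <-> (k <= #|` fset_set (fell_set F `&` V)|)%N.
Proof.
move=> lT hT oV fF; split=> [/hit_manyP [//|//|//|t [ut tV <-]]|kV].
  apply: uniq_leq_size => // x /tV xV.
  by rewrite in_fset_set// inE.
apply/hit_manyP => //; exists (take k (fset_set (fell_set F `&` V))); split.
- by rewrite take_uniq// fset_uniq.
- by move=> x /mem_take; rewrite in_fset_set// inE.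
- by rewrite size_takel.
Qed.

End fell_topology.

(** * Subsemilattice coverings containing prescribed compact sets *)

Lemma bigcup_fset_compact (T : topologicalType) (I : choiceType) (A : {fset I})
    (P : set I) (F : I -> set T) :
  (forall i, i \in A -> compact (F i)) ->
  compact (\bigcup_(i in [set i | i \in A /\ P i]) F i).
Proof.
move=> cF; have fA : finite_set [set i | i \in A /\ P i].
  by apply: (@sub_finite_set _ _ [set` A]) => // i [].
rewrite -bigsetU_fset_set// big_seq.
by apply: bigsetU_compact => i; rewrite in_fset_set// inE => -[/cF].
Qed.

(** Intersections of [W] with subfamilies of [s], [W] itself being the empty one, together with the
    least element [set0]. *)
Fixpoint meet_closure (T : Type) (W : set T) (s : seq (set T)) : seq (set T) :=
  if s is C :: s' then
    meet_closure W s' ++ [seq C `&` X | X <- meet_closure W s']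
  else [:: W; set0].

(** In [meet_closure W s] the largest member is [W], which gives the union, and a set [C] of [s]
    occurs as its own intersection with [W]. *)
Lemma subsemilattice_covering_sub (T : topologicalType) (W : set T)
    (s : seq (set T)) : hausdorff_space T -> compact W ->
  (forall C, C \in s -> compact C /\ C `<=` W) ->
  exists G, subsemilattice_covering W G /\ {subset s <= G}.
Proof.
move=> hT cW sW; exists [fset C in meet_closure W s]%fset.
have Wc s' : W \in meet_closure W s'.
  by elim: s' => [|C s' IH]; rewrite /= ?mem_head// mem_cat IH.
split; last first.
  move=> C; rewrite inE /=; elim: s sW => // D s IH sW.
  rewrite /= mem_cat inE => /predU1P[->|Cs].
    apply/orP; right; apply/mapP; exists W => //.
    by apply/esym/setIidPl; case: (sW D (mem_head _ _)).
  by rewrite IH// => E Es; apply: sW; rewrite inE Es orbT.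
have mW : forall C, C \in meet_closure W s -> compact C /\ C `<=` W.
  elim: (s) sW => [_ C|D s0 IH sW0 C].
    rewrite /= !inE => /orP[]/eqP ->; split => //.
    exact: compact0.
  have {}IH : forall C, C \in meet_closure W s0 -> compact C /\ C `<=` W.
    by apply: IH => E Es; apply: sW0; rewrite inE Es orbT.
  rewrite /= mem_cat => /orP[/IH//|/mapP[E /IH[cE EW] ->]].
  have [cD _] := sW0 D (mem_head _ _).
  by split; [exact: compact_setI|move=> x [_ /EW]].
split.
- by move=> Q; rewrite inE => /mW [].
- rewrite inE /=; elim: (s) => [|C s0 IH].
    by rewrite /= !inE eqxx orbT.
  by rewrite /= mem_cat IH.
- move=> Q1 Q2; rewrite !inE /=; elim: (s) Q1 Q2 => [|C s0 IH] Q1 Q2.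
    rewrite /= !inE => /orP[] /eqP -> /orP[] /eqP ->;
    by rewrite ?(setIid, setI0, set0I) eqxx ?orbT.
  rewrite /= !mem_cat => /orP[Q1s|/mapP[X Xs ->]] /orP[Q2s|/mapP[Y Ys ->]].
  + by rewrite IH.
  + apply/orP; right; apply/mapP; exists (Q1 `&` Y); first exact: IH.
    by rewrite setICA.
  + by apply/orP; right; apply/mapP; exists (X `&` Q2); rewrite ?setIA ?IH.
  + apply/orP; right; apply/mapP; exists (X `&` Y); first exact: IH.
    by rewrite setIACA setIid.
- apply/seteqP; split=> [x [C /=]|x Wx].
    by rewrite inE => /mW [_ CW] /CW.
  by exists W => //; rewrite /= inE; exact: Wc.
Qed.

(** * Cells of closed sets with the same minimal hit members *)

Section traces.
Context {T : ptopologicalType}.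
Implicit Types (G A : {fset set T}) (F : fell T).

Definition trace_cell G A : set (fell T) :=
  miss (avoiding G A) `&` hits (enum_fset A).

(** A member of the cell of [A] hits exactly the elements of [G] above [A], so
    [A] is recovered as the set of minimal hit elements. *)
Lemma trace_cell_above G A F C : trace_cell G A F -> C \in G -> hit C F ->
  exists2 Q, Q \in A & Q `<=` C.
Proof.
move=> [mF _] CG [x [Fx Cx]].
apply: contrapT => nQ; suff : (fell_set F `&` avoiding G A) x by rewrite mF.
split=> //; exists C => //; split=> // Q QA QC.
by apply: nQ; exists Q.
Qed.

(** A member of [A1] is hit, hence contains a member of [A2], which in turn contains a member of
    [A1]; the antichain condition makes all three equal. The other inclusion is symmetric. *)
Lemma trace_cell_inj G A1 A2 F : (A1 `<=` G)%fset -> (A2 `<=` G)%fset ->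
  antichain A1 -> antichain A2 ->
  trace_cell G A1 F -> trace_cell G A2 F -> A1 = A2.
Proof.
have sub A B : (A `<=` G)%fset -> (B `<=` G)%fset -> antichain A ->
    trace_cell G A F -> trace_cell G B F -> (A `<=` B)%fset.
  move=> /fsubsetP AG /fsubsetP BG [_ acA] FA FB; apply/fsubsetP => Q QA.
  have [Q' Q'B Q'Q] := trace_cell_above FB (AG _ QA) (FA.2 _ QA).
  have [Q2 Q2A Q2Q'] := trace_cell_above FA (BG _ Q'B) (FB.2 _ Q'B).
  have Q2Q : Q2 = Q.
    apply: contrapT => /eqP ne; apply: (acA _ _ Q2A QA ne).
    exact: subset_trans Q'Q.
  by have -> : Q = Q' by apply/seteqP; split=> //; rewrite -Q2Q.
move=> A1G A2G ac1 ac2 F1 F2; apply/eqP; rewrite eqEfsubset.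
by apply/andP; split; apply: sub.
Qed.

(** Each set of [s] is hit and so contains a member of [A]. These members are nonempty, since the
    meet that is removed from [G] is [set0], so disjoint sets contain different ones. *)
Lemma trace_cell_card G A F s : (A `<=` remove_meet G)%fset -> set0 \in G ->
  trace_cell G A F -> {subset s <= G} ->
  pairwise (fun C D => `[< C `&` D = set0 >]) s -> hits s F ->
  (size s <= #|` A|)%N.
Proof.
move=> /fsubsetP AG G0 FA sG ps sF.
have meetG : (\bigcap_(Q in [set` G]) Q = set0 :> set T).
  by rewrite -subset0 => x /(_ _ G0).
have A0 Q : Q \in A -> Q !=set0.
  by move=> /AG; rewrite in_fsetD1 meetG => /andP[/set0P].
pose f C := xget set0 [set Q | Q \in A /\ Q `<=` C].
have fA C : C \in s -> f C \in A /\ f C `<=` C.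
  move=> Cs; have [Q QA QC] := trace_cell_above FA (sG _ Cs) (sF _ Cs).
  by apply: (@xgetPex _ set0 [set Q | Q \in A /\ Q `<=` C]); exists Q.
rewrite -(size_map f); apply: uniq_leq_size; last first.
  by move=> _ /mapP[C /fA[? _] ->].
apply: uniq_map_disjoint ps _ => C D /fA[CA fC] /fA[DA fD] e.
have [x fx] := A0 _ CA; exists x; split; first exact: fC.
by apply: fD; rewrite -e.
Qed.

End traces.

(** * Iterated differences as measures of cells, and the bound for many points *)

Lemma measurable_open (X : ptopologicalType) (U : set X) :
  open U -> measurable (U : set (borel X)).
Proof. exact: sub_sigma_algebra. Qed.

Section fell_measurability.
Context {T : ptopologicalType}.
Local Notation fellB := (borel (fell T)).

Lemma measurable_miss Q : compact Q -> measurable (miss Q : set fellB).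
Proof. by move=> cQ; exact: (@measurable_open (fell T) _ (open_miss cQ)). Qed.

Lemma measurable_hit Q : compact Q -> measurable (hit Q : set fellB).
Proof. by move=> cQ; rewrite hitE; apply: measurableC; exact: measurable_miss. Qed.

Lemma measurable_hits s : (forall C, C \in s -> compact C) ->
  measurable (hits s : set fellB).
Proof.
move=> cs; have -> : hits s = \bigcap_(C in [set` s]) hit C by [].
apply: fin_bigcap_measurable => [|C /cs]; first exact: finite_seq.
exact: measurable_hit.
Qed.

Lemma measurable_hit_many V k : measurable (hit_many V k : set fellB).
Proof. exact: (@measurable_open (fell T) _ (open_hit_many V k)). Qed.

Context {R : realType} (lambda : probability fellB R).

Lemma fine_measureID (A B : set fellB) : measurable A -> measurable B ->
  fine (lambda A) = fine (lambda (A `&` B)) + fine (lambda (A `&` ~` B)).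
Proof.
move=> mA mB; rewrite -fineD ?fin_num_measure//; last 2 first.
- exact: measurableI.
- by apply: measurableI => //; exact: measurableC.
rewrite -measureU//; first by rewrite -setIUr setUCr setIT.
- exact: measurableI.
- by apply: measurableI => //; exact: measurableC.
- by rewrite setIACA setICr setI0.
Qed.

(** Splitting along [hit C] shows that [nabla1 C] cancels the constant and cuts [B] down to its part
    in [hit C]. The induction therefore needs arbitrary [B] and [c], with [c] equal to 0 from the
    first step on. *)
Lemma nabla_hits (s : seq (set T)) (Psi : set T -> R) c (B : set fellB) Q :
  measurable B ->
  (forall Q, compact Q -> Psi Q = c - fine (lambda (miss Q `&` B))) ->
  (forall C, C \in s -> compact C) -> compact Q ->
  nabla s Psi Q = (if s is [::] then c else 0) -
    fine (lambda (miss Q `&` (B `&` hits s))).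
Proof.
elim: s Psi c B Q => [|C s IH] Psi c B Q mB PsiB cs cQ.
  rewrite /= PsiB//; congr (_ - fine (lambda _)); congr (_ `&` _).
  by rewrite (_ : hits [::] = setT) ?setIT//; apply/seteqP; split.
have cC : compact C by apply: cs; rewrite mem_head.
rewrite /= (IH _ 0 (B `&` hit C))//.
- rewrite (_ : hits (C :: s) = hit C `&` hits s) ?setIA//; first by case: (s).
  apply/seteqP; split=> [F sF|F [CF sF] D].
    by split=> [|D Ds]; apply: sF; rewrite inE ?eqxx// Ds orbT.
  by rewrite inE => /predU1P[->//|]; exact: sF.
- by apply: measurableI => //; exact: measurable_hit.
- move=> Q' cQ'; rewrite /nabla1 !PsiB//; last exact: compactU.
  rewrite (@fine_measureID (miss Q' `&` B) (hit C)); last 2 first.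
  + by apply: measurableI => //; exact: measurable_miss.
  + exact: measurable_hit.
  rewrite missU setIA hitE setCK.
  rewrite -(setIA (miss Q') B (miss C)) -(setIA (miss Q') (miss C) B).
  by rewrite (setIC B (miss C)); ring.
- by move=> D Ds; apply: cs; rewrite inE Ds orbT.
Qed.

(** Starts from [c = 1] and [B = setT]: [lambda] being a probability, [Phi Q] is one minus the
    measure of [miss Q]. *)
Lemma nabla_hitting (s : seq (set T)) (Phi : set T -> R) Q :
  (forall Q, compact Q -> lambda (hit Q) = (Phi Q)%:E) ->
  s != [::] -> (forall C, C \in s -> compact C) -> compact Q ->
  nabla s Phi Q = - fine (lambda (miss Q `&` hits s)).
Proof.
move=> PhiE s0 cs cQ.
rewrite (@nabla_hits s Phi 1 setT)//; last first.
  move=> Q' cQ'; rewrite setIT; have := @fine_measureID setT (hit Q') measurableT.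
  move=> /(_ (measurable_hit cQ')).
  rewrite !setTI hitE setCK -hitE PhiE//= probability_setT/= => ->.
  by rewrite addrK.
by rewrite setTI; case: (s) s0 => //= *; rewrite sub0r.
Qed.

(** The cells of antichains with at most [n] members have total measure at least [Phi W - delta]. A
    compact part [K] of the event is disjoint from them, and everything lies in [hit W], of measure
    [Phi W]; at most [delta] is left for [K]. *)
Lemma hit_many_le (Phi : set T -> R) delta W (n : nat) :
  locally_compact [set: T] -> hausdorff_space T -> radon lambda ->
  (forall Q, compact Q -> lambda (hit Q) = (Phi Q)%:E) ->
  compact W ->
  (forall G, subsemilattice_covering W G ->
    Phi W - delta <=
    - \sum_(A <- fpowerset (remove_meet G)
        | (#|` A| <= n)%N && `[< antichain A /\ is_opening G A >])
        nabla (enum_fset A) Phi (avoiding G A)) ->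
  (lambda (hit_many W° n.+1) <= delta%:E)%E.
Proof.
move=> lT hT [_ inner _] PhiE cW lfv.
rewrite inner; last exact: open_hit_many.
apply: ge_ereal_sup => _ [K [cK KU] <-].
(* The event is a union over possibly uncountably many packings; finitely many suffice for [K]. *)
have [D DU KD] : finite_subset_cover [set s | packing W° s /\ size s = n.+1]
    (@interior_hits T) K.
  move: cK; rewrite compact_cover; apply => //.
  by move=> s _; exact: open_interior_hits.
have mK : measurable (K : set fellB).
  have := compact_closed (fell_hausdorff lT hT) cK.
  by move=> /closed_openC/measurable_open/measurableC; rewrite setCK.
have Dp s : s \in D -> packing W° s /\ size s = n.+1 by move=> /DU; rewrite inE.
(* A single covering contains the sets of all these packings. *)
have [|G [Gcov sG]] := @subsemilattice_covering_sub _ W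
    (flatten (enum_fset D)) hT cW.
  move=> C /flattenP[s /= /Dp [[sV _] _] /sV [cC CW]]; split => //.
  by apply: subset_trans CW _; exact: interior_subset.
have [Gc G0 _ GW] := Gcov.
have cav A : compact (avoiding G A) by exact: bigcup_fset_compact.
pose cells := [fset A in fpowerset (remove_meet G)
  | (#|` A| <= n)%N && `[< antichain A /\ is_opening G A >]]%fset.
have cellsP A : A \in cells ->
    [/\ (A `<=` remove_meet G)%fset, (#|` A| <= n)%N & antichain A].
  rewrite !inE /= => /andP[]; rewrite fpowersetE => ? /andP[? /asboolP[? _]].
  by split.
have AG A : A \in cells -> (A `<=` G)%fset.
  by move=> /cellsP[+ _ _] => /fsubset_trans; apply; exact: fsubD1set.
have Ac A C : A \in cells -> C \in enum_fset A -> compact C.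
  by move=> /AG/fsubsetP AG' CA; apply/Gc/AG'.
have mcell A : A \in cells -> measurable (trace_cell G A : set fellB).
  move=> Acell; apply: measurableI; first exact: measurable_miss.
  by apply: measurable_hits => C; exact: Ac.
pose E : set fellB := \big[setU/set0]_(A <- cells) trace_cell G A.
have mE : measurable E.
  by rewrite /E big_seq; apply: bigsetU_measurable => A; exact: mcell.
have hitW C F : C `<=` W -> hit C F -> hit W F.
  by move=> CW [x [Fx /CW Wx]]; exists x.
have EP F : E F -> exists2 A, A \in cells & trace_cell G A F.
  by rewrite /E -bigcup_fset => -[A /= ? ?]; exists A.
(* [n.+1] disjoint hit members of [G] would force more than [n] members on the antichain of the
   cell. *)
have KE : K `&` E = set0.
  rewrite -subset0 => F [/KD[s sD sF] /EP[A Acell FA]].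
  have [[sV ps] ssz] := Dp _ sD.
  have [AG' An _] := cellsP _ Acell.
  have : (size s <= #|` A|)%N.
    apply: (trace_cell_card AG' G0 FA _ ps).
      by move=> C Cs; apply/sG/flattenP; exists s.
    move=> C /sF [x [Fx /interior_subset Cx]]; by exists x.
  by rewrite ssz leqNgt ltnS An.
have KEW : K `|` E `<=` hit W.
  move=> F [/KD[s sD sF]|/EP[A Acell [_ sF]]].
    have [[sV ps] ssz] := Dp _ sD.
    (* As [n.+1] is positive, the packing has a first set, and hitting it means hitting [W]. *)
    case: s sF sV ssz {sD ps} => // C s sF sV _.
    have Cs : C \in C :: s by rewrite mem_head.
    apply: (hitW C); first exact: subset_trans (sV _ Cs).2 (@interior_subset _ _).
    by have [x [Fx /interior_subset Cx]] := sF _ Cs; exists x.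
  have [_ _ [A0 _]] := cellsP _ Acell; have /fset0Pn[C CA] := A0.
  apply: (hitW C); last exact: sF.
  move=> x Cx; rewrite -GW; exists C => //=.
  by move/fsubsetP: (AG _ Acell); apply.
(* The cells are disjoint, so their measures add up, and each is minus an iterated difference by
   [nabla_hitting]. *)
have lamE : fine (lambda E) =
    - \sum_(A <- fpowerset (remove_meet G)
        | (#|` A| <= n)%N && `[< antichain A /\ is_opening G A >])
        nabla (enum_fset A) Phi (avoiding G A).
  have <- : \sum_(A <- cells) nabla (enum_fset A) Phi (avoiding G A) =
      \sum_(A <- fpowerset (remove_meet G)
        | (#|` A| <= n)%N && `[< antichain A /\ is_opening G A >])
        nabla (enum_fset A) Phi (avoiding G A).
    by rewrite big_fset.
  rewrite /E measure_fbigsetU//; last first.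
    move=> A B Acell Bcell [F [FA FB]].
    have [_ _ acA] := cellsP _ Acell; have [_ _ acB] := cellsP _ Bcell.
    exact: (trace_cell_inj (AG _ Acell) (AG _ Bcell) acA acB FA FB).
  rewrite -sumrN big_seq [in RHS]big_seq.
  rewrite (eq_bigr (fun A =>
      (- nabla (enum_fset A) Phi (avoiding G A))%:E)) ?sumEFin// => A Acell.
  rewrite (@nabla_hitting (enum_fset A) Phi) ?opprK//.
  - by rewrite fineK// fin_num_measure//; exact: mcell.
  - have [_ _ [A0 _]] := cellsP _ Acell; apply: contra_neq A0 => A0.
    by apply/fsetP => C; rewrite inE -[LHS]/(C \in enum_fset A) A0.
  - by move=> C; exact: Ac.
have := lfv _ Gcov; rewrite -lamE => Elower.
have : (lambda K + lambda E <= (Phi W)%:E)%E.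
  rewrite -measureU// -PhiE//; apply: le_measure => //; rewrite inE.
    exact: measurableU.
  exact: measurable_hit.
have fK : lambda K \is a fin_num by exact: fin_num_measure.
have fE : lambda E \is a fin_num by exact: fin_num_measure.
rewrite -(fineK fK) -(fineK fE) -EFinD lee_fin => KEle.
rewrite -[leLHS](fineK fK) lee_fin.
rewrite -(lerD2r (fine (lambda E))).
by apply: le_trans KEle _; rewrite -lerBlDl.
Qed.

End fell_measurability.

(** * Local finiteness and the counting process *)

Lemma compact_sub_interior (T : ptopologicalType) (Q : set T) :
  locally_compact [set: T] -> hausdorff_space T -> compact Q ->
  exists W, compact W /\ Q `<=` W°.
Proof.
move=> lT hT; rewrite {1}compact_cover => cQ.
have [||D Dc QD] := cQ (set T) compact (@interior T).
- by move=> C _; exact: open_interior.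
- move=> x Qx; have [C [cC Cx _]] := compact_interior_nbhs lT hT openT (I : setT x).
  by exists C.
(* The trivial condition [setT C] only matches the indexing in [bigcup_fset_compact]. *)
exists (\bigcup_(C in [set C | C \in D /\ setT C]) C); split.
  by apply: (@bigcup_fset_compact _ _ D setT id) => C /Dc; rewrite inE.
move=> x /QD [C /= CD Cx]; apply: filterS Cx => y Cy.
by exists C.
Qed.

Section locally_finite_sets.
Context {T : ptopologicalType}.
Implicit Types (F : fell T) (Q V W : set T).
Local Notation fellB := (borel (fell T)).

(** The interiors of the [W n] cover the space, so finitely many of them cover any given compact
    set. Sigma-compactness thus reduces local finiteness to countably many conditions. *)
Lemma locally_finite_exhaustion :
  sigma_compact T -> locally_compact [set: T] -> hausdorff_space T ->
  exists W : nat -> set T, (forall n, compact (W n)) /\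
    forall F, locally_finite F <-> forall n, finite_set (fell_set F `&` (W n)°).
Proof.
move=> [K cK KT] lT hT.
have /choice[W cW] n := compact_sub_interior lT hT (cK n).
exists W; split=> [n|F]; first by have [] := cW n.
split=> [lF n|fF Q].
  apply: sub_finite_set (lF (W n) (cW n).1).
  by apply: setIS; exact: interior_subset.
rewrite compact_cover => cQ.
have [||D _ QD] := cQ nat setT (fun n => (W n)°).
- by move=> n _; exact: open_interior.
- move=> x _; have [n _ Kx] : (\bigcup_n K n) x by rewrite KT.
  by exists n => //; apply: (cW n).2.
apply: (@sub_finite_set _ _ (\bigcup_(n in [set` D]) (fell_set F `&` (W n)°))).
  by move=> x [Fx /QD [n Dn Wx]]; exists n.
by apply: bigcup_finite.
Qed.

Lemma setC_locally_finite (W : nat -> set T) :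
  locally_compact [set: T] -> hausdorff_space T ->
  (forall F, locally_finite F <-> forall n, finite_set (fell_set F `&` (W n)°)) ->
  ~` [set F | locally_finite F] = \bigcup_n \bigcap_k hit_many (W n)° k.
Proof.
move=> lT hT WP; apply/seteqP; split=> F.
  move=> /= /WP/existsNP[n /infinite_hit_many infF]; exists n => // k _.
  by apply: infF => //; exact: open_interior.
move=> [n _ infF] /= /WP/(_ n) fF.
have : infinite_set (fell_set F `&` (W n)°); last exact.
apply/infinite_hit_many => // [|k]; first exact: open_interior.
exact: infF.
Qed.

Lemma measurable_locally_finite :
  sigma_compact T -> locally_compact [set: T] -> hausdorff_space T ->
  measurable ([set F | locally_finite F] : set fellB).
Proof.
move=> sT lT hT; have [W [_ WP]] := locally_finite_exhaustion sT lT hT.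
rewrite -[X in measurable X]setCK; apply: measurableC.
rewrite (setC_locally_finite lT hT WP).
apply: bigcupT_measurable => n; apply: bigcapT_measurable => k.
exact: measurable_hit_many.
Qed.

(** For each [n] and each [e], having infinitely many points in the interior of [W n] lies in an
    event of measure at most [e], so it is null; a countable union of null events is null. *)
Lemma locally_finite_null (R : realType) (lambda : probability fellB R)
    (Phi : set T -> R) :
  sigma_compact T -> locally_compact [set: T] -> hausdorff_space T ->
  radon lambda ->
  (forall Q, compact Q -> lambda (hit Q) = (Phi Q)%:E) ->
  locally_finite_valuation Phi ->
  lambda (~` [set F | locally_finite F]) = 0%E.
Proof.
move=> sT lT hT rl PhiE lfv.
have [W [cW WP]] := locally_finite_exhaustion sT lT hT.
rewrite (setC_locally_finite lT hT WP).
have mW n : measurable (\bigcap_k hit_many (W n)° k : set fellB).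
  by apply: bigcapT_measurable => k; exact: measurable_hit_many.
apply: measure_negligible; first exact: bigcupT_measurable.
apply: negligible_bigcup => n; apply/negligibleP; first exact: mW.
apply/eqP; rewrite eq_le measure_ge0 andbT.
apply/lee_addgt0Pr => e e0; rewrite add0e.
have [m /(hit_many_le lT hT rl PhiE (cW n)) Wm] := lfv e (W n) e0 (cW n).
apply: le_trans Wm; apply: le_measure; rewrite ?inE//.
  exact: measurable_hit_many.
exact: bigcap_inf.
Qed.

Lemma card_fset_setU (A B : set T) : finite_set A -> finite_set B ->
  (#|` fset_set A| + #|` fset_set B| =
   #|` fset_set (A `|` B)| + #|` fset_set (A `&` B)|)%N.
Proof. by move=> fA fB; rewrite fset_setU// fset_setI// cardfsUI. Qed.

(** [|F ∩ Q|] is neither upper nor lower semicontinuous, but it is the difference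
    of the lower semicontinuous counts of the open sets [W°] and [W° \ Q]. *)
Lemma measurable_count Q k :
  sigma_compact T -> locally_compact [set: T] -> hausdorff_space T ->
  compact Q ->
  measurable ([set F | locally_finite F /\
    #|` fset_set (fell_set F `&` Q)| = k] : set fellB).
Proof.
move=> sT lT hT cQ; have [W [cW QW]] := compact_sub_interior lT hT cQ.
have oW : open W° by exact: open_interior.
have oWQ : open (W° `\` Q) by apply: open_setD => //; exact: compact_closed.
pose exactly V m : set fellB := hit_many V m `\` hit_many V m.+1.
have mex V m : measurable (exactly V m).
  by apply: measurableD; exact: measurable_hit_many.
have exE V m F : open V -> finite_set (fell_set F `&` V) ->
    exactly V m F <-> #|` fset_set (fell_set F `&` V)| = m.
  move=> oV fF; rewrite /exactly/= !finite_hit_many//; split=> [[m1 m2]|<-//].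
    by apply/eqP; rewrite eqn_leq m1 andbT leqNgt; exact/negP.
  by split=> //; rewrite ltnn.
(* Here [m] is the number of points in [W°] outside [Q]. *)
rewrite (_ : [set F | _] = [set F | locally_finite F] `&`
    \bigcup_m (exactly W° (k + m)%N `&` exactly (W° `\` Q) m)).
  apply: measurableI; first exact: measurable_locally_finite.
  by apply: bigcupT_measurable => m; exact: measurableI.
have fin F V : locally_finite F -> V `<=` W -> finite_set (fell_set F `&` V).
  by move=> lF VW; apply: sub_finite_set (lF W cW); exact: setIS.
have fW F : locally_finite F -> finite_set (fell_set F `&` W°).
  by move=> /fin; apply; exact: interior_subset.
have fQ F : locally_finite F -> finite_set (fell_set F `&` Q).
  by move=> lF; exact: lF.
have fWQ F : locally_finite F -> finite_set (fell_set F `&` (W° `\` Q)).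
  by move=> /fin; apply => x [/interior_subset].
have cardE F : locally_finite F ->
    (#|` fset_set (fell_set F `&` Q)| + #|` fset_set (fell_set F `&` (W° `\` Q))| =
     #|` fset_set (fell_set F `&` W°)|)%N.
  move=> lF; rewrite card_fset_setU; [|exact: fQ|exact: fWQ].
  rewrite -setIUr setDUK// setIACA setDIK setI0.
  by rewrite fset_set0 cardfs0 addn0.
apply/seteqP; split=> F [lF].
  move=> Fk; split => //; exists #|` fset_set (fell_set F `&` (W° `\` Q))| => //.
  by split; apply/exE => //; [exact: fW|rewrite -Fk -cardE|exact: fWQ].
move=> [m _ [/exE-/(_ oW (fW _ lF)) Wm /exE-/(_ oWQ (fWQ _ lF)) WQm]].
by split=> //; move: (cardE _ lF); rewrite Wm WQm => /addIn.
Qed.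

(** Closed sets that are not locally finite get the default count 0, so they enter the event for
    [k = 0] only. *)
Lemma measurable_count_points Q k :
  sigma_compact T -> locally_compact [set: T] -> hausdorff_space T ->
  compact Q ->
  measurable ([set F | count_points (@id (fell T)) Q F = k] : set fellB).
Proof.
move=> sT lT hT cQ; have mLF := measurable_locally_finite sT lT hT.
rewrite (_ : [set F | _] = [set F | locally_finite F /\
      #|` fset_set (fell_set F `&` Q)| = k] `|`
    (~` [set F | locally_finite F] `&` [set F | 0%N = k])).
  apply: measurableU; first exact: measurable_count.
  apply: measurableI; first exact: measurableC.
  have [k0|k0] := pselect (0%N = k).
    by rewrite (_ : [set _ | _] = setT)//; apply/seteqP; split.
  by rewrite (_ : [set _ | _] = set0)//; apply/seteqP; split.
rewrite /count_points; apply/seteqP; split=> F /=.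
  by case: asboolP; [left|right].
by case: asboolP => lF [[]|[]].
Qed.

Lemma valuation_count_points (R : realType) (Omega : Type) (xi : Omega -> fell T)
    (w : Omega) :
  locally_compact [set: T] -> hausdorff_space T ->
  valuation (fun Q => (count_points xi Q w)%:R : R).
Proof.
move=> lT hT; rewrite /count_points; case: asboolP => lF; last first.
  split; last by move=> *; rewrite addr0.
  split=> // E _ e e0; exists setT; split=> // [|F _ _ _]; first exact: openT.
  by rewrite subrr normr0.
have fF Q : compact Q -> finite_set (fell_set (xi w) `&` Q) by exact: lF.
split; last first.
  move=> Q1 Q2 cQ1 cQ2; rewrite -!natrD card_fset_setU; [|exact: fF|exact: fF].
  by rewrite -setIUr setIACA setIid.
split.
- by move=> Q _; exact: ler0n.
- by rewrite setI0 fset_set0 cardfs0.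
- move=> Q1 Q2 cQ1 cQ2 Q12; rewrite ler_nat; apply: fsubset_leq_card.
  by rewrite -fset_set_sub; [exact: setIS|exact: fF|exact: fF].
move=> E cE e e0; have [W [cW EW]] := compact_sub_interior lT hT cE.
(* Only finitely many points of [xi w] lie in [W]. Removing those outside [E] leaves an open set
   around [E] in which a larger compact set gains no points. *)
exists (W° `\` ((fell_set (xi w) `&` W) `\` E)); split.
- apply: open_setD; first exact: open_interior.
  by apply: finite_closed => //; apply: finite_setD; exact: fF.
- by move=> x Ex; split; [exact: EW|case].
move=> Q cQ EQ QG.
rewrite (_ : fell_set (xi w) `&` Q = fell_set (xi w) `&` E).
  by rewrite subrr normr0.
apply/seteqP; split; last exact: setIS.
move=> x [Fx /QG [Wx nx]]; split=> //; apply: contrapT => nEx.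
by apply: nx; split=> //; split=> //; exact: interior_subset.
Qed.

Lemma count_points_set1_le1 (Omega : Type) (xi : Omega -> fell T) a w :
  (count_points xi [set a] w <= 1)%N.
Proof.
rewrite /count_points; case: ifP => // _.
rewrite -(cardfs1 a); apply: fsubset_leq_card.
rewrite -fset_set1 -fset_set_sub; [by move=> x []| |exact: finite_set1].
by apply: sub_finite_set (finite_set1 a) => x [].
Qed.

End locally_finite_sets.

Theorem theorem1p3 (R : realType) (T : ptopologicalType)
  (sigma_compactT : sigma_compact T)
  (locally_compactT : locally_compact [set: T])
  (hausdorffT : hausdorff_space T)
  (Phi : set T -> R)
  (capacity_Phi : capacity Phi)
  (normalized_Phi : normalized Phi)
  (alternating_Phi : completely_alternating Phi)
  (lambda : probability (borel (fell T)) R)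
  (radon_lambda : radon lambda)
  (Phi_lambda : forall Q : set T, compact Q -> lambda (hit Q) = (Phi Q)%:E)
  (lfv_Phi : locally_finite_valuation Phi) :
  [/\ measurable ([set F | locally_finite F] : set (borel (fell T))),
      lambda (~` [set F | locally_finite F]) = 0%E,
      forall (d : measure_display) (Omega : measurableType d)
        (P : probability Omega R) (xi : {mfun Omega >-> borel (fell T)}),
        has_distribution lambda P xi ->
        [/\ {ae P, forall w, locally_finite (xi w)},
            point_process R (count_points xi)
          & simple (count_points xi)]
    & exists mu : probability realizations R,
        is_count_distribution lambda mu /\
        forall mu' : probability realizations R,
          is_count_distribution lambda mu' ->
          forall A : set realizations, measurable A -> mu' A = mu A].
Proof.
have mLF := measurable_locally_finite sigma_compactT locally_compactT hausdorffT.
have null := locally_finite_null sigma_compactT locally_compactT hausdorffT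
  radon_lambda Phi_lambda lfv_Phi.
have mcount Q k := @measurable_count_points _ Q k sigma_compactT
  locally_compactT hausdorffT.
split=> //.
- move=> d Omega P xi xi_lambda; split.
  (* The exceptional set is the preimage of a Borel set that is null for [lambda]. *)
  + exists (xi @^-1` (~` [set F | locally_finite F])); split => //.
    * rewrite -[X in measurable X]setTI.
      by apply: measurable_funPT => //; exact: measurableC.
    * by rewrite -null -xi_lambda//; exact: measurableC.
  + split=> [Q cQ _ Y _|w]; last exact: valuation_count_points.
    (* Counts are integers, so the preimage of any [Y] is a countable union of level events, each
       pulled back from a Borel set of closed sets. *)
    rewrite setTI (_ : _ @^-1` Y =
        \bigcup_(k in Y) (xi @^-1` [set F | count_points (@id (fell T)) Q F = k])).
      apply: bigcup_measurable => k _; rewrite -[X in measurable X]setTI.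
      by apply: measurable_funPT => //; exact: mcount.
    apply/seteqP; split=> w /=; first by exists (count_points xi Q w).
    by case=> k + /= kE; rewrite -kE.
  + by move=> a w; exact: count_points_set1_le1.
(* The counts of any [xi] are [c] composed with [xi], so the image of [lambda] under [c] is their
   distribution. Measurability of [c] is checked on the generating [count_cylinders]. *)
pose c (F : borel (fell T)) : @realizations T :=
  fun Q => count_points (@id (fell T)) Q F.
have mc : measurable_fun [set: borel (fell T)] c.
  apply: (@measurability _ _ (borel (fell T)) (@realizations T) setT c
    count_cylinders) => //.
  move=> _ [_ [Q cQ [k _ <-]] <-]; rewrite setTI.
  exact: mcount.
pose C : {mfun borel (fell T) >-> @realizations T} := mfun_Sub (mem_set mc).
have mid : measurable_fun [set: borel (fell T)] (@id (borel (fell T))).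
  exact: measurable_id.
(* Under [lambda] itself the identity is a random closed set with distribution [lambda]; testing
   [mu'] on it gives uniqueness. *)
pose J : {mfun borel (fell T) >-> borel (fell T)} := mfun_Sub (mem_set mid).
exists (distribution lambda C); split.
  move=> d Omega P xi xi_lambda A mA.
  have mcA : measurable (c @^-1` A).
    by rewrite -[X in measurable X]setTI; exact: (mc measurableT).
  exact: xi_lambda _ mcA.
move=> mu' mu'_count A mA.
by rewrite -(mu'_count _ _ lambda J).
Qed.
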